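(* There is a constant $a>0$ such that for every integer $r \geq 3$ and every integer $0 \leq f \leq r+1$, and for all large enough $n$, every $n$-vertex $r$-graph with no $(r+1,f)$-subset contains a homogeneous set of size at least $\big(\log_{(r-2)}(n)\big)^{a}$.
   Context: An $r$-graph is an $r$-uniform hypergraph. A homogeneous set in an $r$-graph is a vertex set that is either a clique (all its $r$-subsets are edges) or an independent set (none of its $r$-subsets is an edge). An $(m,f)$-subset of a hypergraph is a set of $m$ vertices which induces exactly $f$ edges. $\log_{(k)}$ denotes the $k$-th iterated logarithm: $\log_{(1)}(x)=\log x$ and $\log_{(k)}(x)=\log(\log_{(k-1)}(x))$; logarithms are base 2. ''Large enough $n$'' may depend on $r$ and $f$. *)

(* Defs.v *)
From HB Require Import structures.
From mathcomp Require Import all_boot all_order all_algebra.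
From mathcomp Require Import all_classical all_reals all_analysis.

Set Implicit Arguments.
Unset Strict Implicit.
Unset Printing Implicit Defensive.

Import Order.TTheory GRing.Theory Num.Theory.

Local Open Scope ring_scope.

Section Hypergraphs.
Variable T : finType.
Implicit Types (E : {set {set T}}) (A S : {set T}) (r m f : nat).

(* A hypergraph with vertex set T is identified with its edge set E. *)
Definition uniform_hypergraph r E : Prop := forall e, e \in E -> #|e| = r.

Definition clique r E A : Prop :=
  forall e : {set T}, e \subset A -> #|e| = r -> e \in E.

Definition independent r E A : Prop :=
  forall e : {set T}, e \subset A -> #|e| = r -> e \notin E.

Definition homogeneous r E A : Prop := clique r E A \/ independent r E A.

Definition induced_edges E S : {set {set T}} := [set e in E | e \subset S].

Definition mf_subset m f E S : Prop :=
  #|S| = m /\ #|induced_edges E S| = f.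

End Hypergraphs.

Definition log2 (R : realType) (x : R) : R := ln x / ln 2.

(* The library's ln is 0 on nonpositive reals, so this is total; it is the usual
   k-th iterated logarithm as soon as all the intermediate values are positive. *)
Definition iter_log2 (R : realType) (k : nat) (x : R) : R := iter k (@log2 R) x.

(* Main.v *)
Require Import Defs.
From HB Require Import structures.
From mathcomp Require Import all_boot all_order all_algebra.
From mathcomp Require Import all_classical all_reals all_analysis.
From mathcomp Require Import zify.

Set Implicit Arguments.
Unset Strict Implicit.
Unset Printing Implicit Defensive.

Import Order.TTheory GRing.Theory Num.Theory.

(** The Erdos-Rado argument turns a colouring of the [k.+1]-subsets of a linearly
    ordered set of size [2 ^ (t ^ k.+1)] into one on a subset of size [t] where
    the colour of a set no longer depends on its last vertex
    ([last_vertex_irrelevant]) or, reading the order backwards, on its first one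
    ([first_vertex_irrelevant]).  Each use costs one logarithm, and [r - 2] uses
    reduce an [r]-graph to a graph [g] on pairs.  One more use of Ramsey's theorem,
    for graphs, would cost a further logarithm; the forbidden [(r.+1, f)]-subsets
    are there to avoid it.

    The point is that one may choose how many times to forget the first vertex,
    [p], and the last vertex, [q], as long as [p + q = r - 2].  Whether a set is an
    edge is then [g x y], for [x] and [y] its vertices in positions [p] and
    [p.+1] counted from [0].  In a set of [r.+1] vertices, written
    [a ++ x :: y :: z :: b] with [size a = p] and [size b = q], deleting [x] or a
    vertex of [a] leaves the decisive pair [(y, z)], deleting [y] leaves [(x, z)],
    and deleting [z] or a vertex of [b] leaves [(x, y)].  So the set induces
    [p.+1 * g y z + g x z + q.+1 * g x y] edges ([count_removals]).

    For every [f] there are [p], [q] and two colours [b], [d] such that this number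
    is [f] as soon as [g x y = g x z = b] and [g y z = d] ([exists_split]):
    for [0 < f < r], one takes [p.+1 = f], [b = false] and [d = true].  With no
    [(r.+1, f)]-subset, the [b]-coloured neighbours of [x] that come after [x] are
    therefore pairwise coloured [~~ d].  Either some [x] has [M] such neighbours, or
    a greedy choice among [M * M] vertices gives [M] vertices pairwise coloured
    [~~ b] ([greedy_homogeneous]).  Homogeneous sets of [g] are homogeneous in the
    [r]-graph, so that the size obtained is a fixed power of the number of vertices
    left after the [r - 2] reductions, which is itself at least a fixed power of the
    [(r - 2)]-fold logarithm of [n]. *)

(** * Forgetting the last vertex *)

Section LastVertex.
Variables (T : eqType).
Implicit Types (s p S u H : seq T) (x y z : T) (c : seq T -> bool).

(** Each test at worst halves the list: keep the majority value. *)
Lemma common_value_subseq (I : eqType) (f : I -> T -> bool) (ws : seq I) q S :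
  2 ^ size ws * q <= size S ->
  exists S', [/\ subseq S' S, q <= size S' &
    {in ws, forall w, {in S' &, forall y y', f w y = f w y'}}].
Proof.
elim: ws S => [|w ws IHws] S /=; first by rewrite mul1n => ?; exists S.
rewrite expnS => leS.
have [b leb] : exists b, 2 ^ size ws * q <= size [seq y <- S | f w y == b].
  have := count_predC (f w) S; rewrite -!size_filter => eqS.
  have [le1|lt1] := leqP (2 ^ size ws * q) (size (seq.filter (f w) S)).
    by exists true; under eq_filter do rewrite eqb_id.
  exists false; rewrite (@eq_filter _ _ (predC (f w))) => [|y]; last first.
    by rewrite eqbF_neg.
  by move: leS eqS lt1; rewrite -mulnA; lia.
have [S' [sS' leS' fS']] := IHws _ leb.
exists S'; split => //; first exact: subseq_trans sS' (filter_subseq _ _).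
move=> v; rewrite in_cons => /predU1P[->|/fS'//] y y' yS' y'S'.
have := mem_subseq sS' yS'; have := mem_subseq sS' y'S'.
by rewrite !mem_filter => /andP[/eqP-> _] /andP[/eqP-> _].
Qed.

(** Words with repetitions stand for the [j]-subsets of [p]: they are easier to
    enumerate, and [size p ^ j] of them are still few enough. *)
Definition words j p : seq (seq T) :=
  iter j (fun W => [seq x :: w | x <- p, w <- W]) [:: [::]].

Lemma size_words j p : size (words j p) = size p ^ j.
Proof. by elim: j => //= j IHj; rewrite size_allpairs IHj expnS. Qed.

Lemma mem_words p (w : seq T) : {subset w <= p} -> w \in words (size w) p.
Proof.
elim: w => //= x w IHw sub; apply: allpairs_f; first exact/sub/mem_head.
by apply: IHw => y yw; apply: sub; rewrite in_cons yw orbT.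
Qed.

(** The colour of [rcons w y] depends on [w] alone, but this is required only for
    [w] inside [p].  With [p] a prefix of [s], this is the invariant of the
    Erdos-Rado construction, where [p] is the part already chosen and the rest of
    [s] is the reservoir; with [p = s] it is the property wanted at the end. *)
Definition end_determined (c : seq T -> bool) k p s := forall (w : seq T) y y',
  size w = k -> subseq w p -> subseq (rcons w y) s -> subseq (rcons w y') s ->
  c (rcons w y) = c (rcons w y').

Lemma subseq_rconsE (w : seq T) p x :
  subseq w (rcons p x) -> subseq w p \/ exists2 w', w = rcons w' x & subseq w' p.
Proof.
rewrite -subseq_rev rev_rcons; case/lastP: w => [|w y].
  by left; rewrite sub0seq.
rewrite rev_rcons /=; case: eqP => [->|_ sw].
  by rewrite subseq_rev; right; exists w.
by left; rewrite -subseq_rev rev_rcons.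
Qed.

(** In a duplicate-free list, the letter that follows [x] in a subsequence lies
    beyond the only occurrence of [x]. *)
Lemma mem_after (w : seq T) x y p S : uniq (rcons p x ++ S) ->
  subseq (rcons (rcons w x) y) (rcons p x ++ S) -> y \in S.
Proof.
elim: p w => [|z p IHp] [|v w] /andP[zp un].
- by rewrite /= eqxx sub1seq.
- rewrite /=; case: eqP => _ /mem_subseq sub.
    by case/negP: zp; apply: sub; rewrite mem_rcons in_cons mem_rcons mem_head orbT.
  by apply: sub; rewrite -rcons_cons mem_rcons mem_head.
- rewrite /=; case: eqP => [xz|_]; last exact: (IHp [::]).
  by case/negP: zp; rewrite -xz mem_cat mem_rcons mem_head.
rewrite /=; case: eqP => _; first exact: IHp.
exact: (IHp (v :: w)).
Qed.

(** One step of the Erdos-Rado construction moves the head [x] of the reservoir [S]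
    to [p].  The new words to take care of are [rcons w x] with [w] of length [j] in
    [p], so that at most [size p ^ j < K] halvings of the reservoir are needed: a
    reservoir of size [2 ^ (t * K)] lasts for [t] steps. *)
Lemma end_determined_extend c j t K p S :
  uniq (p ++ S) -> (size p + t) ^ j < K -> 2 ^ (t * K) <= size S ->
  end_determined c j.+1 p (p ++ S) ->
  exists q, [/\ subseq q S, size q = t & end_determined c j.+1 (p ++ q) (p ++ q)].
Proof.
elim: t p S => [|t IHt] p S uS ltK leS edS.
  exists [::]; split=> //; first exact: sub0seq.
  rewrite cats0 => w y y' sw wp wy wy'.
  by apply: edS => //; apply: subseq_trans (prefix_subseq _ _).
case: S uS leS edS => [_|x S uS leS edS].
  by rewrite leqn0 expn_eq0.
have /common_value_subseq : 2 ^ size (words j p) * 2 ^ (t * K) <= size S.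
  rewrite size_words -expnD; have lej : size p ^ j < K.
    by apply: leq_ltn_trans ltK; case: (j) => [|i] //; rewrite leq_exp2r // leq_addr.
  rewrite -ltnS; apply: leq_trans leS.
  by rewrite mulSn ltn_exp2l // ltn_add2r.
move=> /(_ (fun w y => c (rcons (rcons w x) y)))[S' [sS' leS' cS']].
(* The words that end before [x] keep their property from [p ++ S]; those that
   end at [x] get it from the choice of [S']. *)
have sxS : subseq (rcons p x ++ S') (p ++ x :: S).
  by rewrite cat_rcons cat_subseq //= eqxx.
have uS' := subseq_uniq sxS uS.
case: (IHt (rcons p x) S') => //.
- by rewrite size_rcons addSnnS.
- move=> w y y' sw wp wy wy'; case: (subseq_rconsE wp) => [wp'|[v eqw vp]].
    by apply: edS => //; apply: subseq_trans sxS.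
  subst w; have [vy vy'] := (mem_after uS' wy, mem_after uS' wy').
  move: sw; rewrite size_rcons => -[sv]; apply: cS' => //.
  by rewrite -sv; apply/mem_words/mem_subseq.
move=> q [qS' sq edq]; exists (x :: q); split.
- by rewrite /= eqxx (subseq_trans qS').
- by rewrite /= sq.
- by rewrite -cat_rcons.
Qed.

Lemma last_vertex_irrelevant c j t s :
  1 < t -> uniq s -> 2 ^ (t ^ j.+2) <= size s ->
  exists s' (c' : seq T -> bool), [/\ subseq s' s, size s' = t &
    forall (w : seq T) y, size w = j.+1 -> subseq (rcons w y) s' ->
      c (rcons w y) = c' w].
Proof.
move=> t1 us les.
have [||||s' [ss' st ed]] := @end_determined_extend c j t (t ^ j).+1 [::] s => //.
- by apply: leq_trans les; rewrite leq_exp2l // !expnS; have : 0 < t ^ j; nia.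
- by move=> [].
(* The common colour of the extensions of [w] in [s'] is that of any one of them. *)
exists s', (fun w => has (fun y => subseq (rcons w y) s' && c (rcons w y)) s').
split=> // w y sw wy; apply/idP/hasP => [cw|[y' _ /andP[wy' cw]]].
  by exists y; rewrite ?wy //; apply: (mem_subseq wy); rewrite mem_rcons mem_head.
suff -> : c (rcons w y) = c (rcons w y') by [].
by apply: ed => //; apply: subseq_trans (subseq_rcons _ _) wy.
Qed.

End LastVertex.

(** * Reduction to a colouring of pairs *)

Section PairReduction.
Variable T : eqType.
Implicit Types (s a b H : seq T) (x y z : T) (c : seq T -> bool).

Lemma first_vertex_irrelevant c j t s :
  1 < t -> uniq s -> 2 ^ (t ^ j.+2) <= size s ->
  exists s' (c' : seq T -> bool), [/\ subseq s' s, size s' = t &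
    forall (w : seq T) y, size w = j.+1 -> subseq (y :: w) s' ->
      c (y :: w) = c' w].
Proof.
move=> t1 us les.
have [||s' [c' [ss' st cc']]] :=
  @last_vertex_irrelevant _ (c \o rev) j t (rev s) t1; rewrite ?rev_uniq ?size_rev //.
exists (rev s'), (c' \o rev); rewrite size_rev -subseq_rev revK; split=> // w y sw.
rewrite -subseq_rev revK rev_cons => /cc'; rewrite size_rev => /(_ sw) /=.
by rewrite rev_rcons revK.
Qed.

Definition pair_determined c p q s (g : rel T) := forall a x y b,
  size a = p -> size b = q -> subseq (a ++ x :: y :: b) s ->
  c (a ++ x :: y :: b) = g x y.

(** A number of vertices from which forgetting [m] vertices one after the other, in
    sets of size [m.+2], leaves [t] vertices.  The recursion peels off the first of
    these steps, where the sets still have their full size. *)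
Fixpoint er_bound m t :=
  if m is m'.+1 then 2 ^ (er_bound m' t ^ m'.+3) else t.

Lemma er_bound_gt1 m t : 1 < t -> 1 < er_bound m t.
Proof.
move=> t1; elim: m => //= m IHm.
by rewrite -{1}(expn0 2) ltn_exp2l // expn_gt0 (ltnW IHm).
Qed.

Lemma pair_determined_subseq c p q t s :
  1 < t -> uniq s -> er_bound (p + q) t <= size s ->
  exists s' g, [/\ subseq s' s, size s' = t & pair_determined c p q s' g].
Proof.
move=> t1; elim: p c s => [|p IHp] c s us.
  rewrite add0n; elim: q c s us => [|q IHq] c s us les.
    exists (take t s), (fun x y => c [:: x; y]); split; first exact: take_subseq.
      by rewrite size_takel.
    by move=> [|//] x y [|//].
  have [s1 [c1 [ss1 st1 cc1]]] :=
    last_vertex_irrelevant c (er_bound_gt1 q t1) us les.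
  have [s2 [g [ss2 st2 cg]]] := IHq c1 s1 (subseq_uniq ss1 us) (eq_leq (esym st1)).
  exists s2, g; split=> //; first exact: subseq_trans ss1.
  move=> [|//] x y b _ sb sub; case/lastP: b sb sub => [//|b z].
  rewrite size_rcons => -[sb] /=; rewrite -!rcons_cons => sub.
  rewrite cc1 /= ?sb //; last exact: subseq_trans ss2.
  by apply: (cg [::]) => //; apply: subseq_trans sub; exact: subseq_rcons.
move=> les.
have [s1 [c1 [ss1 st1 cc1]]] :=
  first_vertex_irrelevant c (er_bound_gt1 (p + q) t1) us les.
have [s2 [g [ss2 st2 cg]]] := IHp c1 s1 (subseq_uniq ss1 us) (eq_leq (esym st1)).
exists s2, g; split=> //; first exact: subseq_trans ss1.
move=> [//|z a] x y b [sa] sb /= sub.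
rewrite cc1; last exact: subseq_trans ss2.
  by apply: cg => //; apply: subseq_trans (subseq_cons _ _) sub.
by rewrite size_cat /= sa sb !addnS.
Qed.

(** Look at the first vertex [x]: if [M] later vertices are joined to it in colour
    [b], the hypothesis makes them homogeneous of colour [d]; otherwise drop these
    fewer than [M] vertices, add [x] to the [~~ b]-homogeneous set under
    construction, and go on with the others. *)
Lemma greedy_homogeneous (g : rel T) (b d : bool) M m s :
  (forall x y z, subseq [:: x; y; z] s -> g x y = b -> g x z = b -> g y z = d) ->
  m * M <= size s ->
  exists H, subseq H s /\
    (size H = M /\ pairwise (fun x y => g x y == d) H \/
     size H = m /\ pairwise (fun x y => g x y == ~~ b) H).
Proof.
elim: m s => [|m IHm] s gs les; first by exists [::]; rewrite sub0seq; split; auto.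
case: s gs les => [|x s] gs les.
  exists [::]; split=> //; left; move: les; rewrite leqn0 muln_eq0 /= => /eqP->.
  by [].
pose N := [seq y <- s | g x y == b].
have [leMN|ltNM] := leqP M (size N).
  exists (take M N); split; last left.
    by apply: subseq_trans (subseq_cons _ _); apply: subseq_trans (filter_subseq _ _); apply: take_subseq.
  rewrite size_takel //; split=> //; apply: subseq_pairwise (take_subseq _ _) _.
  have : {in N, forall y, g x y = b} by move=> y; rewrite mem_filter => /andP[/eqP].
  have : subseq N s by apply: filter_subseq.
  elim: N {leMN} => //= y N IHN sub Nb.
  rewrite IHN; first last.
  - by move=> z zN; apply: Nb; rewrite in_cons zN orbT.
  - by apply: subseq_trans sub; apply: subseq_cons.
  rewrite andbT; apply/allP => z zN; apply/eqP/(gs x).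
  - by rewrite /= eqxx; apply: subseq_trans sub; rewrite /= eqxx sub1seq.
  - exact/Nb/mem_head.
  - by apply: Nb; rewrite in_cons zN orbT.
pose N' := [seq y <- s | g x y != b].
have [||H [HN' hH]] := IHm N'.
- move=> u y z sub; apply: gs; apply: subseq_trans (subseq_cons _ _).
  exact: subseq_trans sub (filter_subseq _ _).
- have := count_predC (fun y => g x y == b) s; rewrite -!size_filter -/N.
  by rewrite -[seq.filter (predC _) _]/N'; move: les; rewrite /= mulSn; lia.
have Hs : subseq H s by apply: subseq_trans HN' (filter_subseq _ _).
case: hH => [[sH hH]|[sH hH]].
  by exists H; split; [apply: subseq_trans (subseq_cons _ _) | left].
exists (x :: H); rewrite /= eqxx sH hH; split=> //; right; split=> //.
rewrite andbT; apply/allP => y /(mem_subseq HN'); rewrite mem_filter => /andP[].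
by case: (g x y) (b) => [] [].
Qed.

End PairReduction.

(** * Edges induced by r + 1 vertices *)

Lemma count_const (T : eqType) (P : pred T) (v : bool) (s : seq T) :
  {in s, forall x, P x = v} -> count P s = size s * v.
Proof.
move=> Pv; rewrite (eq_in_count (a2 := fun=> v)) //.
by case: v {Pv}; rewrite ?count_predT ?count_pred0 ?muln1 ?muln0.
Qed.

(** Deleting a vertex of [a], or [x], shifts the decisive positions [p] and [p.+1]
    to [y] and [z]; deleting a vertex of [b], or [z], leaves them at [x] and [y]. *)
Lemma count_removals (T : eqType) (c : seq T -> bool) p q s g a x y z b :
  pair_determined c p q s g -> uniq s -> size a = p -> size b = q ->
  subseq (a ++ x :: y :: z :: b) s ->
  count (fun i => c (rem i (a ++ x :: y :: z :: b))) (a ++ x :: y :: z :: b) =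
  p.+1 * g y z + g x z + q.+1 * g x y.
Proof.
set u := a ++ _ => cg us sa sb sub; have uu := subseq_uniq sub us.
have remE i l1 l2 : u = l1 ++ i :: l2 -> rem i u = l1 ++ l2.
  move=> uE; move: uu; rewrite uE; elim: (l1) => [|k l IHl] /=.
    by rewrite eqxx.
  by case/andP; rewrite mem_cat in_cons !negb_or eq_sym eq_sym => /and3P[_ /negPf-> _] /IHl->.
have sub_rem i l1 l2 : u = l1 ++ i :: l2 -> subseq (l1 ++ l2) s.
  move=> uE; apply: subseq_trans sub; rewrite uE cat_subseq //; exact: subseq_cons.
have in_a : {in a, forall i, c (rem i u) = g y z}.
  move=> i /splitPr ia; case: ia @u sa {uu sub} remE sub_rem => a1 a2 u sa remE sub_rem.
  have uE : u = a1 ++ i :: (a2 ++ x :: y :: z :: b) by rewrite /u -catA.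
  rewrite (remE _ _ _ uE); have := sub_rem _ _ _ uE.
  rewrite catA -cat_rcons => sub; apply: cg => //.
  by rewrite -sa size_rcons !size_cat /= addnS.
have in_b : {in b, forall i, c (rem i u) = g x y}.
  move=> i /splitPr ib; case: ib @u sb {uu sub in_a} remE sub_rem => b1 b2 u sb remE sub_rem.
  have uE : u = (a ++ x :: y :: z :: b1) ++ i :: b2 by rewrite /u -catA.
  rewrite (remE _ _ _ uE); have := sub_rem _ _ _ uE.
  rewrite -catA /= => sub; apply: cg => //.
  by rewrite -sb /= !size_cat /= addnS.
rewrite /u count_cat -/u (count_const in_a) /= (count_const in_b).
rewrite (remE x a (y :: z :: b)) // (cg _ y z b) ?(sub_rem x) //.
have uE : u = rcons a x ++ y :: z :: b by rewrite cat_rcons.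
rewrite (remE _ _ _ uE) cat_rcons (cg _ x z b) //; last first.
  by rewrite -cat_rcons; apply: sub_rem uE.
have {}uE : u = (a ++ [:: x; y]) ++ z :: b by rewrite -catA.
rewrite (remE _ _ _ uE) -catA (cg _ x y b) //; last first.
  by have := sub_rem _ _ _ uE; rewrite -catA.
by rewrite sa sb; case: (g x y) (g y z) => [] []; lia.
Qed.

(** The [r]-subsets of a set of [r.+1] vertices are the complements of its vertices. *)
Lemma card_induced_edges (T : finType) (E : {set {set T}}) r (u : seq T) :
  uniform_hypergraph r E -> uniq u -> size u = r.+1 ->
  #|induced_edges E [set:: u]| = count (fun i => [set:: rem i u] \in E) u.
Proof.
move=> Er uu su; pose S := [set:: u].
have remS i : [set:: rem i u] = S :\ i.
  by apply/setP=> j; rewrite !inE mem_rem_uniq ?inE.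
have cS : #|S| = r.+1.
  by rewrite -su -(card_uniqP uu); apply: eq_card => i; rewrite inE.
have -> : induced_edges E [set:: u] = [set S :\ i | i in [set i in S | S :\ i \in E]].
  apply/setP=> e; rewrite inE; apply/andP/imsetP => [[eE eS]|[i]]; last first.
    by rewrite inE => /andP[_ iE ->]; rewrite subD1set.
  have /eqP/cards1P[i Si] : #|S :\: e| = 1.
    by have := cardsID e S; rewrite (finset.setIidPr eS) (Er e eE) cS; lia.
  have eE' : e = S :\ i by rewrite -Si finset.setDDr finset.setDv finset.set0U (finset.setIidPr eS).
  exists i => //; rewrite inE -eE' eE andbT.
  by have : i \in S :\: e by [rewrite Si set11]; rewrite inE => /andP[].
rewrite card_in_imset; last first.
  move=> i j; rewrite !inE => /andP[iS _] /andP[jS _] /setP/(_ i).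
  by rewrite !inE eqxx iS andbT; case: eqP.
rewrite -size_filter -(card_uniqP (filter_uniq _ uu)); apply: eq_card => i.
by rewrite mem_filter remS !inE andbC.
Qed.

(** The right-hand side is the number of edges in [count_removals] when
    [g x y = g x z = b] and [g y z = d].  With [b = false] it takes the value [0],
    and, through the choice of [p], all values from [1] to [r - 1]; the values [r]
    and [r.+1] come from [b = true] and [p = 0]. *)
Lemma exists_split r f : 2 < r -> f <= r.+1 ->
  exists p q (b d : bool), r = (p + q).+2 /\ f = p.+1 * d + b + q.+1 * b.
Proof.
move=> r2 fr; case: (posnP f) => [->|f0]; first by exists 0, r.-2, false, false; lia.
case: (ltnP f r) => [ltfr|].
  by exists f.-1, (r - f).-1, false, true; lia.
rewrite leq_eqVlt => /predU1P[<-|?]; first by exists 0, r.-2, true, false; lia.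
by exists 0, r.-2, true, true; lia.
Qed.

(** The [r - 2] extra vertices beyond [M * M] are set aside as the [p] first and the
    [q] last ones: any three vertices [x], [y], [z] of the middle part can then be
    completed to a set of [r.+1] vertices where they occupy the positions [p],
    [p.+1] and [p.+2]. *)
Lemma homogeneous_of_er_bound (T : finType) (E : {set {set T}}) r f M :
  2 < r -> f <= r.+1 -> 1 < M -> uniform_hypergraph r E ->
  (forall S : {set T}, ~ mf_subset r.+1 f E S) ->
  er_bound (r - 2) (M * M + (r - 2)) <= #|T| ->
  exists A : {set T}, homogeneous r E A /\ M <= #|A|.
Proof.
move=> r2 fr M1 Er noE; have [p [q [b [d [rpq fE]]]]] := exists_split r2 fr.
have -> : r - 2 = p + q by lia.
rewrite cardE => leT; pose c (u : seq T) := [set:: u] \in E.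
have t1 : 1 < M * M + (p + q) by nia.
have [s [g [se ss cg]]] := pair_determined_subseq c t1 (enum_uniq T) leT.
have us := subseq_uniq se (enum_uniq T).
have [l [m [l' [sE sl sm sl']]]] :
    exists l m l', [/\ s = l ++ m ++ l', size l = p, size m = M * M & size l' = q].
  exists (take p s), (take (M * M) (drop p s)), (drop (M * M) (drop p s)).
  by rewrite !cat_take_drop !size_take_min !size_drop ss; split=> //; lia.
have pattern x y z : subseq [:: x; y; z] m -> g x y = b -> g x z = b -> g y z = ~~ d.
  move=> xyz gxy gxz; apply/eqP; rewrite -[_ == _]negbK; apply/negP => gyz.
  have {}gyz : g y z = d by case: (g y z) (d) gyz => [] [].
  have sub : subseq (l ++ x :: y :: z :: l') s.
    by rewrite sE cat_subseq // -[_ :: _]/([:: x; y; z] ++ l') cat_subseq.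
  have uu := subseq_uniq sub us.
  have su : size (l ++ x :: y :: z :: l') = r.+1 by rewrite size_cat /= sl sl'; lia.
  apply: (noE [set:: l ++ x :: y :: z :: l']); split.
    by rewrite -su -(card_uniqP uu); apply: eq_card => i; rewrite inE.
  by rewrite (card_induced_edges Er) // (count_removals cg) // gxy gxz gyz fE.
have [H [Hm hH]] := greedy_homogeneous pattern (eq_leq (esym sm)).
have [v [sH gH]] : exists v, size H = M /\ pairwise (fun x y => g x y == v) H.
  by case: hH; [exists (~~ d) | exists (~~ b)].
have Hs : subseq H s.
  by rewrite sE -[H]cats0; apply: (@cat_subseq _ [::]); rewrite ?sub0seq ?cat_subseq ?sub0seq.
exists [set:: H]; split; last first.
  rewrite -sH -(card_uniqP (subseq_uniq Hs us)).
  by apply: subset_leq_card; apply/fintype.subsetP => i; rewrite inE.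
have EH (e : {set T}) : e \subset [set:: H] -> #|e| = r -> (e \in E) = v.
  move=> eH er; pose u := [seq i <- H | i \in e].
  have uH : subseq u H by apply: filter_subseq.
  have uE : [set:: u] = e.
    apply/setP=> i; rewrite inE mem_filter; case ie: (i \in e) => //=.
    by have := fintype.subsetP eH i ie; rewrite inE.
  have su : size u = r.
    rewrite -er -uE -(card_uniqP (subseq_uniq (subseq_trans uH Hs) us)).
    by apply: eq_card => i; rewrite inE.
  clearbody u; rewrite -uE; move: (subseq_trans uH Hs) (subseq_pairwise uH gH) su.
  rewrite -(cat_take_drop p u) => sub pw su.
  have sp : size (take p u) = p.
    by rewrite size_takel //; move: su; rewrite cat_take_drop rpq -!addnS => ->; rewrite leq_addr.
  move: su sub pw; rewrite size_cat sp rpq -!addnS => /addnI.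
  case: (drop p u) => [|x [|y b']] //= [sb'] sub.
  rewrite pairwise_cat => /and3P[_ _ /= /andP[/andP[/eqP<- _] _]].
  exact: cg sub.
by case: v {sH gH} EH => EH; [left | right] => e eH er; rewrite EH.
Qed.

(** * Towers and iterated logarithms *)

Definition tower m x := iter m (expn 2) x.

Lemma leq_tower m : {homo tower m : x y / x <= y}.
Proof. by elim: m => //= m IHm x y lexy; rewrite leq_exp2l // IHm. Qed.

Lemma tower_ge m x : x <= tower m x.
Proof. by elim: m => //= m IHm; apply: leq_trans IHm (ltnW (ltn_expl _ _)). Qed.

(** Only the power at the top of the tower matters, [t ^ 3] in [er_bound 1 t]; its
    exponent is raised to [4] to absorb constant factors.  Powers at the lower
    levels are absorbed in turn by the induction hypothesis, which is why it has to
    hold for an arbitrary [C]. *)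
Lemma er_bound_exp_tower m C :
  exists t0, forall t, t0 <= t -> er_bound m.+1 t ^ C <= tower m.+1 (t ^ 4).
Proof.
elim: m C => [|m IHm] C.
  exists C => t leCt; rewrite /= -expnM leq_exp2l // (expnSr t 3) leq_mul2l leCt.
  by rewrite orbT.
have [t0 ht0] := IHm (m.+4 + C); exists (maxn 2 t0) => t.
rewrite geq_max => /andP[t2 /ht0 leh].
rewrite [er_bound _ _]/= [tower _ _]/= -expnM leq_exp2l //.
(* A constant factor [C] costs at most [C] more powers of a number above [1]. *)
apply: leq_trans leh; rewrite expnD leq_mul2l; apply/orP; right.
apply: (@leq_trans (2 ^ C)); first exact/ltnW/ltn_expl.
by case: (C) => [|C'] //; rewrite leq_exp2r // er_bound_gt1.
Qed.

Local Open Scope ring_scope.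

(** For [x <= 0] the inequality still holds because [ln x] is then [0]. *)
Lemma le_log2 (R : realType) (x y : R) : 1 <= y -> x <= y -> log2 x <= log2 y.
Proof.
move=> y1 xy; rewrite /log2 ler_pM2r ?invr_gt0 ?ln_gt0 ?ltr1n //.
have [x0|x0] := ltP 0 x; first by rewrite ler_ln ?posrE // (lt_le_trans x0).
by rewrite ln0 // ln_ge0.
Qed.

Lemma iter_log2_le (R : realType) m (x : R) (y : nat) :
  (0 < y)%N -> x <= (tower m y)%:R -> iter_log2 m x <= y%:R.
Proof.
move=> y0; elim: m x => [|m IHm] x lex; first exact: lex.
rewrite /iter_log2 iterSr; apply: IHm.
have -> : (tower m y)%:R = log2 ((2 ^ tower m y)%:R : R).
  have ln2 : ln (2 : R) != 0 by rewrite gt_eqF // ln_gt0 // ltr1n.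
  by rewrite /log2 natrX lnXn // -[ln 2 *+ _]mulr_natl mulfK.
by apply: le_log2 => //; rewrite ler1n expn_gt0.
Qed.

Lemma powR_le_root (R : realType) k (x : R) (M : nat) :
  (0 < k)%N -> (0 < M)%N -> x <= (M ^ k)%:R -> x `^ (k%:R^-1) <= M%:R.
Proof.
move=> k0 M0 xM; have [x0|x0] := ltP 0 x.
  have -> : M%:R = (M ^ k)%:R `^ k%:R^-1 :> R.
    by rewrite natrX -powR_mulrn // -powRrM mulfV ?powRr1 // pnatr_eq0 -lt0n.
  by apply: ge0_ler_powR; rewrite ?invr_ge0 ?nnegrE // ltW.
apply: (@le_trans _ _ 1); last by rewrite ler1n.
rewrite /powR; case: eqP => _; first by case: (_ == _).
by rewrite ln0 // mulr0 expR0.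
Qed.

(** The exponent [12] is [3 * 4]: at most [M ^ 3] vertices have to survive the
    reductions, and [er_bound_exp_tower] asks for a tower over their fourth power. *)
Lemma tower_lt_cofinal m M0 n : (tower m (M0 ^ 12) <= n)%N ->
  exists M, [/\ M0 <= M, tower m (M ^ 12) <= n & n < tower m (M.+1 ^ 12)]%N.
Proof.
move=> leM0; pose P M := (M0 <= M)%N && (tower m (M ^ 12) <= n)%N.
have [|M|M /andP[le1 le2] maxM] := @ex_maxnP P n; first by exists M0; rewrite /P leqnn.
  case/andP=> _ leM; apply: leq_trans leM; apply: leq_trans (tower_ge _ _).
  by case: M => // M; rewrite -{1}[M.+1]expn1 leq_pexp2l.
exists M; split=> //; rewrite ltnNge; apply/negP => leS.
have : P M.+1 by rewrite /P leS leqW.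
by move/maxM; rewrite ltnn.
Qed.

Theorem proposition1p2 (R : realType) :
  exists a : R, 0 < a /\
    forall r f : nat, (3 <= r)%N -> (f <= r.+1)%N ->
    exists n0 : nat, forall n : nat, (n0 <= n)%N ->
    forall (T : finType) (E : {set {set T}}),
      #|T| = n -> uniform_hypergraph r E ->
      (forall S : {set T}, ~ mf_subset r.+1 f E S) ->
      exists A : {set T},
        homogeneous r E A /\ iter_log2 (r - 2) (n%:R : R) `^ a <= #|A|%:R.
Proof.
(* The largest [M] with [tower _ (M ^ 12) <= n] makes the iterated logarithm at most
   [M.+1 ^ 12 <= M ^ 24]. *)
exists 24%:R^-1; split=> [|r f r3 fr]; first by rewrite invr_gt0 ltr0n.
have -> : (r - 2 = (r - 3).+1)%N by lia.
have [t0 ht0] := er_bound_exp_tower (r - 3) 1.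
exists (tower (r - 3).+1 ((t0 + r) ^ 12)) => n len T E cT Er noE.
have [M [leM leMn ltnM]] := tower_lt_cofinal len.
have [||A [homA leA]] := @homogeneous_of_er_bound T E r f M r3 fr _ Er noE.
- by apply: leq_trans leM; lia.
- have -> : (r - 2 = (r - 3).+1)%N by lia.
  rewrite cT; apply: leq_trans leMn; set t := (M * M + _)%N.
  have /ht0 : (t0 <= t)%N by rewrite /t; nia.
  rewrite expn1 => /leq_trans; apply; apply: leq_tower.
  rewrite (expnM M 3 4) leq_exp2r // /t !expnS; nia.
exists A; split=> //; apply: (@le_trans _ _ M%:R); last by rewrite ler_nat.
apply: powR_le_root => //; first lia.
apply: (@le_trans _ _ (M.+1 ^ 12)%:R).
  by apply: iter_log2_le; rewrite ?expn_gt0 // ler_nat ltnW.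
rewrite ler_nat (expnM M 2 12) leq_exp2r // !expnS; nia.
Qed.
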